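(* Let $(G,i)$ be a filter pair over the signature $\Sigma$. (i) For any homomorphism of $\Sigma$-structures $f:A\to B$ and $\Gamma\cup\{\varphi\}\subseteq A$: $\Gamma\vdash^A\varphi\ \Rightarrow\ f[\Gamma]\vdash^B f(\varphi)$. (ii) For any injective map of sets $f:X\to Y$ and $\Gamma\cup\{\varphi\}\subseteq Fm(X)$: $\Gamma\vdash^X\varphi\ \Leftrightarrow\ f[\Gamma]\vdash^Y f(\varphi)$, where $f$ also denotes the induced homomorphism $Fm(X)\to Fm(Y)$.
   Context: $\Sigma$-Str is the category of $\Sigma$-structures and homomorphisms; $Fm(X)$ is the absolutely free $\Sigma$-structure on a set $X$. $AL$ is the category of algebraic lattices with maps preserving arbitrary meets and directed joins. A filter pair over $\Sigma$ is a pair $(G,i)$ of a contravariant functor $G:\Sigma\text{-Str}\to AL$ and maps $i_A:G(A)\to(\mathcal{P}(A),\subseteq)$, one for each $\Sigma$-structure $A$, preserving arbitrary infima (in particular $i_A(\top)=A$) and directed suprema, such that $i_A\circ G(h)=h^{-1}\circ i_B$ for every homomorphism $h:A\to B$. For a $\Sigma$-structure $A$ and $\Gamma\cup\{\varphi\}\subseteq A$: $\Gamma\vdash^A\varphi$ iff for every $a\in G(A)$, $\Gamma\subseteq i_A(a)$ implies $\varphi\in i_A(a)$. For a set $X$, $\vdash^X$ denotes $\vdash^{Fm(X)}$. *)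

(* Defs.v *)
From mathcomp Require Import all_boot all_order.
From mathcomp Require Import boolp classical_sets.

Set Implicit Arguments.
Unset Strict Implicit.
Unset Printing Implicit Defensive.

Local Open Scope classical_set_scope.

(* [ops S n] is the set of connectives of arity [n]. *)
Record signature : Type := Signature { ops : nat -> Type }.

(* Carriers are allowed to be empty. *)
Record structure (S : signature) : Type := Structure {
  carrier :> Type ;
  interp : forall n, ops S n -> ('I_n -> carrier) -> carrier }.
Arguments interp {S} _ {n}.

Record hom (S : signature) (A B : structure S) : Type := Hom {
  hom_fun :> A -> B ;
  homP : forall n (o : ops S n) (args : 'I_n -> A),
    hom_fun (interp A o args) = interp B o (hom_fun \o args) }.

Definition hom_id (S : signature) (A : structure S) : hom A A :=
  @Hom S A A idfun (fun n o args => erefl).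

Lemma hom_compP (S : signature) (A B C : structure S)
    (g : hom B C) (f : hom A B) n (o : ops S n) (args : 'I_n -> A) :
  (g \o f) (interp A o args) = interp C o ((g \o f) \o args).
Proof. by rewrite /= !homP. Qed.

Definition hom_comp (S : signature) (A B C : structure S)
    (g : hom B C) (f : hom A B) : hom A C := Hom (hom_compP g f).

Inductive term (S : signature) (X : Type) : Type :=
| Var of X
| App n of ops S n & ('I_n -> term S X).
Arguments Var {S X}.
Arguments App {S X n}.

Definition Fm (S : signature) (X : Type) : structure S :=
  @Structure S (term S X) (fun n o args => App o args).

Section FreeExtension.
Variables (S : signature) (X : Type) (A : structure S) (v : X -> A).

Fixpoint Fm_eval (t : term S X) : A :=
  match t with
  | Var x => v x
  | App n o args => interp A o (fun i => Fm_eval (args i))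
  end.

(* The unique homomorphism out of [Fm S X] extending the valuation [v]. *)
Definition Fm_ext : hom (Fm S X) A :=
  @Hom S (Fm S X) A Fm_eval (fun n o args => erefl).
End FreeExtension.

Definition Fm_map (S : signature) (X Y : Type) (f : X -> Y) :
    hom (Fm S X) (Fm S Y) :=
  @Fm_ext S X (Fm S Y) (Var \o f).

Section CompletePosets.
Variables (d : Order.disp_t) (L : porderType d).

Definition complete_lattice : Prop :=
  forall D : set L, supremums D !=set0 /\ infimums D !=set0.

Definition directed (D : set L) : Prop :=
  D !=set0 /\
  forall x y, D x -> D y -> exists z, [/\ D z, (x <= z)%O & (y <= z)%O].

Definition compact_element (c : L) : Prop :=
  forall (D : set L) (s : L), directed D -> supremums D s -> (c <= s)%O ->
    exists2 x, D x & (c <= x)%O.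

Definition algebraic : Prop :=
  forall x : L, supremums [set c | compact_element c /\ (c <= x)%O] x.
End CompletePosets.

Record algLattice : Type := AlgLattice {
  al_disp : Order.disp_t ;
  al_sort :> porderType al_disp ;
  al_complete : complete_lattice al_sort ;
  al_algebraic : algebraic al_sort }.

Section Preservation.
Variables (d d' : Order.disp_t) (L : porderType d) (M : porderType d').

(* Arbitrary families, the empty one included: the top element is preserved. *)
Definition preserves_infima (f : L -> M) : Prop :=
  forall (D : set L) (x : L), infimums D x -> infimums (f @` D) (f x).

Definition preserves_directed_suprema (f : L -> M) : Prop :=
  forall (D : set L) (x : L), directed D -> supremums D x ->
    supremums (f @` D) (f x).
End Preservation.

Record alHom (L M : algLattice) : Type := AlHom {
  alHom_fun :> L -> M ;
  alHom_inf : preserves_infima alHom_fun ;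
  alHom_dsup : preserves_directed_suprema alHom_fun }.

(* The codomain [set A] of [fp_i A] carries the library's order on sets,
   which is inclusion ([subsetEset]). *)
Record filterPair (S : signature) : Type := FilterPair {
  fp_obj : structure S -> algLattice ;
  fp_mor : forall A B : structure S, hom A B -> alHom (fp_obj B) (fp_obj A) ;
  fp_mor_id : forall (A : structure S) (a : fp_obj A),
    fp_mor (hom_id A) a = a ;
  fp_mor_comp : forall (A B C : structure S) (g : hom B C) (f : hom A B)
      (c : fp_obj C),
    fp_mor (hom_comp g f) c = fp_mor f (fp_mor g c) ;
  fp_i : forall A : structure S, fp_obj A -> set A ;
  fp_i_inf : forall A : structure S, preserves_infima (@fp_i A) ;
  fp_i_dsup : forall A : structure S, preserves_directed_suprema (@fp_i A) ;
  fp_i_natural : forall (A B : structure S) (h : hom A B) (b : fp_obj B),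
    fp_i (fp_mor h b) = h @^-1` fp_i b }.

Definition entails (S : signature) (G : filterPair S) (A : structure S)
    (Gamma : set A) (phi : A) : Prop :=
  forall a : fp_obj G A, Gamma `<=` fp_i a -> fp_i a phi.

(* Main.v *)
Require Import Defs.
From mathcomp Require Import all_boot all_order.
From mathcomp Require Import boolp classical_sets.

(** Filters pull back along homomorphisms by naturality of [i], so entailment
    is pushed forward. For injective [f : X -> Y] the homomorphism induced by
    [f] has a left inverse: send [f x] to [x] and every other variable to [phi],
    an element of [Fm(X)] that is available even when [X] is empty. Pushing
    forward along this left inverse gives the converse in (ii). *)

Local Open Scope classical_set_scope.

Lemma entails_hom (S : signature) (G : filterPair S) (A B : structure S)
    (f : hom A B) (Gamma : set A) (phi : A) :
  entails G Gamma phi -> entails G (f @` Gamma) (f phi).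
Proof.
move=> Gphi b fGb.
suff: fp_i (fp_mor G f b) phi by rewrite fp_i_natural.
by apply: Gphi => a Ga; rewrite fp_i_natural; apply: fGb; exists a.
Qed.

(** The composite is an endomorphism of [Fm S X] fixing every variable, hence the identity by
    induction on terms. *)
Lemma Fm_ext_mapK (S : signature) (X Y : Type) (f : X -> Y)
    (v : Y -> Fm S X) :
  (forall x, v (f x) = Var x) -> cancel (Fm_map S f) (Fm_ext v).
Proof.
move=> vf; elim=> [x|n o args IH] /=; first exact: vf.
by congr App; apply/funext => i; exact: IH.
Qed.

(** The term [t] witnesses that [Fm S X] is inhabited: with [X] empty, no constants and [Y]
    nonempty, no [g] could exist. *)
Lemma Fm_map_inj_retraction (S : signature) (X Y : Type) (f : X -> Y)
    (t : Fm S X) :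
  injective f -> exists g : hom (Fm S Y) (Fm S X), cancel (Fm_map S f) g.
Proof.
move=> f_inj.
have [v vf] : exists v : Y -> Fm S X, forall x, v (f x) = Var x.
  (* Vacuous for [y] outside the range of [f], so any default value serves there. *)
  have /choice[v vP] y : exists u : Fm S X, forall x, f x = y -> u = Var x.
    have [[x fx]|nfy] := pselect (exists x, f x = y).
      by exists (Var x) => x' fx'; congr Var; apply: f_inj; rewrite fx fx'.
    by exists t => x fx; case: nfy; exists x.
  by exists v => x; exact: vP.
by exists (Fm_ext v); exact: Fm_ext_mapK.
Qed.

Theorem proposition2p13 (S : signature) (G : filterPair S) :
  (forall (A B : structure S) (f : hom A B) (Gamma : set A) (phi : A),
     entails G Gamma phi -> entails G (f @` Gamma) (f phi)) /\
  (forall (X Y : Type) (f : X -> Y), injective f ->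
     forall (Gamma : set (Fm S X)) (phi : Fm S X),
       entails G Gamma phi <->
       entails G (Fm_map S f @` Gamma) (Fm_map S f phi)).
Proof.
split=> [A B f Gamma phi|X Y f f_inj Gamma phi]; first exact: entails_hom.
split=> [|fGphi]; first exact: entails_hom.
have [g fK] := Fm_map_inj_retraction S X Y f phi f_inj.
have := entails_hom S G _ _ g _ _ fGphi; rewrite fK => Gphi a Ga.
(* The image of [Gamma] under [Fm_map S f] and then [g] is [Gamma] again. *)
by apply: Gphi => _ [_ [t Gt <-] <-]; rewrite fK; exact: Ga.
Qed.
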